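(* Let $n,k,s,p,r$ be integers with $s\ge 1$, $1\le r\le k$ and $r\le p\le s+r-1$, and put $q=(k-r)(s+1)+p$. Suppose $\mathcal F\subset\binom{[n]}{k}$ has property $U(s+1,q)$, i.e. $|F_1\cup\ldots\cup F_{s+1}|\le q$ for all choices of $F_1,\ldots,F_{s+1}\in\mathcal F$. Define $$f(s,p,r):=s(s+1)\cdot\frac{\sum_{j=0}^{r-1}s^{r-1-j}\binom{p}{j}}{\binom{p}{r}}.$$ If $n\ge p+1+(s+f(s,p,r))(k-r)$, then $|\mathcal F|\le|\mathcal A_{p,r}|$, where $\mathcal A_{p,r}:=\{A\in\binom{[n]}{k}: |A\cap[p]|\ge r\}$.
   Context: $[n]=\{1,\ldots,n\}$, $\binom{[n]}{k}$ is the set of all $k$-subsets of $[n]$, and $[p]=\{1,\ldots,p\}$. In the union condition the sets $F_i$ need not be distinct. *)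

(* Defs.v *)
From mathcomp Require Import all_boot all_order all_algebra.

Set Implicit Arguments.
Unset Strict Implicit.
Unset Printing Implicit Defensive.

(* The ground set [n] = {1, ..., n} is modelled by 'I_n, the element i of [n]
   being the ordinal of value i - 1; thus [p] is the set of ordinals < p. *)

Definition ksubsets (n k : nat) : {set {set 'I_n}} :=
  [set A : {set 'I_n} | #|A| == k].

Definition initseg (n p : nat) : {set 'I_n} := [set i : 'I_n | i < p].

(* Property U(m, q); the sets G i need not be distinct. *)
Definition propU (n m q : nat) (F : {set {set 'I_n}}) : Prop :=
  forall G : 'I_m -> {set 'I_n},
    (forall i, G i \in F) -> #|\bigcup_(i < m) G i| <= q.

Definition Afam (n k p r : nat) : {set {set 'I_n}} :=
  [set A in ksubsets n k | r <= #|A :&: initseg n p|].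

Definition fspr (s p r : nat) : rat :=
  ((s * (s + 1))%:R
   * ((\sum_(j < r) s ^ (r - 1 - j) * 'C(p, j))%N%:R / 'C(p, r)%:R))%R.

(* Main.v *)
Require Import Defs.
From mathcomp Require Import all_boot all_order all_algebra.
From mathcomp Require Import fingroup perm zify ring.

(** The family may be assumed left-shifted. Write [n = p + 1 + m], [l = k - r],
    and let [L B] be the family of traces on the last [m] points of the members
    of [F] meeting the first [p + 1] points exactly in [B]. If [|B| < r], then
    [L B] has no [s + 1] pairwise disjoint members, so by Frankl's shadow theorem
    and shiftedness [|L B| <= s |L (B + y)|] for each [y] outside [B]. Hence the
    members of [F] outside [A_{p,r}] number at most [(s + 1)] times a weighted sum
    of the [|L (B + (p + 1))|] with [B] an [(r - 1)]-subset of [[p]].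

    For such a [B], the families [L (B + (p + 1)) <= L (B + y_1) <= L (B + y_2) ...],
    with [y_i] decreasing through [[p] \ B] and the last one repeated up to [s]
    times, contain no disjoint system of representatives: its union would have
    [p + 1 + (s + 1) l] elements. Averaging over circular orders of the [m] points
    this forces the [s] larger families to miss at least [m / l - s] times
    [|L (B + (p + 1))|] sets of size [l] in total. Double counting turns this into
    enough members of [A_{p,r}] missing from [F]. *)

Set Implicit Arguments.
Unset Strict Implicit.
Unset Printing Implicit Defensive.

Import Order.TTheory GRing.Theory Num.Theory.

(** * Shifting *)

Definition swap_elt (T : finType) (i j : T) (A : {set T}) : {set T} :=
  i |: (A :\ j).

Definition left_shifted (n : nat) (F : {set {set 'I_n}}) : Prop :=
  forall (A : {set 'I_n}) (i j : 'I_n),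
    A \in F -> i < j -> j \in A -> i \notin A -> swap_elt i j A \in F.

Section Shift.
Variables (n : nat) (i j : 'I_n) (F : {set {set 'I_n}}).
Hypothesis lt_ij : i < j.

(** In Frankl's [(i, j)]-shift a set moves only if its image is not yet in [F]; this makes the map
    injective on [F]. *)
Definition movable (A : {set 'I_n}) : bool :=
  [&& j \in A, i \notin A & swap_elt i j A \notin F].

Definition shift_set (A : {set 'I_n}) : {set 'I_n} :=
  if movable A then swap_elt i j A else A.

Definition shift_fam : {set {set 'I_n}} := [set shift_set A | A in F].

Lemma swap_eltK (A : {set 'I_n}) :
  j \in A -> i \notin A -> swap_elt j i (swap_elt i j A) = A.
Proof.
move=> jA iA; apply/setP=> x; rewrite !inE.
case: (eqVneq x j) => [->|xj] /=; first by rewrite jA.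
by case: (eqVneq x i) => [->|xi] //=; rewrite (negPf iA).
Qed.

Lemma card_swap_elt (A : {set 'I_n}) :
  j \in A -> i \notin A -> #|swap_elt i j A| = #|A|.
Proof.
move=> jA iA; rewrite cardsU1 !inE (negPf iA) andbF /= add1n.
by rewrite [in RHS](cardsD1 j) jA.
Qed.

Lemma shift_set_inj : {in F &, injective shift_set}.
Proof.
move=> A B AF BF; rewrite /shift_set.
case: ifP => [/and3P[jA iA sA]|_]; case: ifP => [/and3P[jB iB sB]|_] //.
- by move=> e; rewrite -(swap_eltK jA iA) e swap_eltK.
- by move=> e; rewrite e BF in sA.
- by move=> e; rewrite -e AF in sB.
Qed.

Lemma card_shift_fam : #|shift_fam| = #|F|.
Proof. exact: card_in_imset shift_set_inj. Qed.

Lemma shift_fam_uniform k :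
  F \subset ksubsets n k -> shift_fam \subset ksubsets n k.
Proof.
move/subsetP=> Fk; apply/subsetP=> _ /imsetP[A AF ->].
have := Fk _ AF; rewrite !inE /shift_set.
by case: ifP => // /and3P[jA iA _]; rewrite card_swap_elt.
Qed.

(** The termination measure: a shift that moves some set lowers it, so repeated shifting stops at a
    left-shifted family. *)
Definition total_weight (G : {set {set 'I_n}}) : nat :=
  \sum_(A in G) \sum_(a in A) (a : nat).

Lemma total_weight_shift (A : {set 'I_n}) :
  A \in F -> movable A -> total_weight shift_fam < total_weight F.
Proof.
have wswap B : movable B ->
    \sum_(a in swap_elt i j B) (a : nat) < \sum_(a in B) (a : nat).
  case/and3P=> jB iB _.
  rewrite big_setU1 ?inE ?(negPf iB) ?andbF //=.
  by rewrite [ltnRHS](big_setD1 j) //= ltn_add2r.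
have wle B : \sum_(a in shift_set B) (a : nat) <= \sum_(a in B) (a : nat).
  by rewrite /shift_set; case: ifP => // /wswap /ltnW.
move=> AF mA; rewrite /total_weight big_imset /=; last exact: shift_set_inj.
rewrite (bigD1 A) //= [ltnRHS](bigD1 A) //= -addSn.
by rewrite leq_add ?leq_sum // /shift_set mA wswap.
Qed.

(* Undoing the shift on the new sets brings [j] back; applying it to the old
   sets that contain [j] but not [i] keeps them in [F] and supplies [i]. *)
Lemma shift_fam_propU m q : propU m q F -> propU m q shift_fam.
Proof.
move=> FU G GS.
have [allF|] := boolP [forall a, G a \in F]; first by apply: FU; apply/forallP.
rewrite negb_forall => /existsP[a0 a0F].
have newP a : G a \notin F ->
    [/\ i \in G a, j \notin G a & swap_elt j i (G a) \in F].
  have /imsetP[A AF ->] := GS a; rewrite /shift_set.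
  case: ifP => [/and3P[jA iA sA] _|]; last by rewrite AF.
  rewrite swap_eltK // !inE eqxx /=; split => //.
  by rewrite eqxx orbF; apply: contraTneq lt_ij => ->; rewrite ltnn.
have oldP a : G a \in F -> j \in G a -> i \notin G a ->
    swap_elt i j (G a) \in F.
  have /imsetP[A AF ->] := GS a; rewrite /shift_set.
  case: ifP => [/and3P[jA iA sA]|]; first by rewrite (negPf sA).
  by move=> mA _ jA iA; move: mA; rewrite /movable jA iA /= => /negbFE.
pose G' a := if G a \notin F then swap_elt j i (G a)
  else if (j \in G a) && (i \notin G a) then swap_elt i j (G a) else G a.
have G'F a : G' a \in F.
  rewrite /G'; case: ifP => [/newP[]//|/negbFE aF].
  by case: ifP => // /andP[]; apply: oldP.
apply: leq_trans (FU _ G'F).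
set U := \bigcup_(a < m) G a; set U' := \bigcup_(a < m) G' a.
have [ia0 ja0 _] := newP _ a0F.
have jU' : j \in U'.
  by apply/bigcupP; exists a0 => //; rewrite /G' a0F !inE eqxx.
have UU' x : x != i -> x != j -> x \in U -> x \in U'.
  move=> xi xj /bigcupP[a _ xa]; apply/bigcupP; exists a => //.
  by rewrite /G'; do 2?case: ifP => _ //; rewrite !inE xa ?xi ?xj orbT.
(* If [j] lies in [U], then [U'] contains [U], an old set through [j] supplying [i]. Otherwise only
   [i] can be lost, and [j] replaces it. *)
have [jU|jU] := boolP (j \in U).
  apply/subset_leq_card/subsetP=> x xU.
  have [->//|xj] := eqVneq x j.
  have [->|xi] := eqVneq x i; last exact: UU'.
  have /bigcupP[b _ jb] := jU.
  have bF : G b \in F by apply: contraLR jb => /newP[].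
  apply/bigcupP; exists b => //; rewrite /G' bF jb /=.
  by case: ifP => [|/negbFE//]; rewrite !inE eqxx.
have iU : i \in U by apply/bigcupP; exists a0.
rewrite (cardsD1 i) iU /=.
have -> : 1 + #|U :\ i| = #|j |: (U :\ i)|.
  by rewrite cardsU1 !inE (negPf jU) andbF.
apply/subset_leq_card/subsetP=> x; rewrite !inE.
case: (eqVneq x j) => [->//|xj] /= /andP[xi xU]; exact: UU'.
Qed.

End Shift.

Lemma left_shifted_witness n k m q (F : {set {set 'I_n}}) :
  F \subset ksubsets n k -> propU m q F ->
  exists F' : {set {set 'I_n}},
    [/\ F' \subset ksubsets n k, propU m q F', #|F'| = #|F| & left_shifted F'].
Proof.
have [N] := ubnP (total_weight F); elim: N => // N IH in F * => ltN Fk FU.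
have [sh|] := boolP [forall A in F, forall i : 'I_n, forall j : 'I_n,
  (i < j) ==> ~~ movable i j F A].
  exists F; split=> // A i j AF ij jA iA.
  have /forall_inP/(_ _ AF)/forallP/(_ i)/forallP/(_ j) := sh.
  by rewrite ij /movable jA iA /= negbK.
rewrite negb_forall_in => /exists_inP[A AF].
rewrite negb_forall => /existsP[i]; rewrite negb_forall => /existsP[j].
rewrite negb_imply negbK => /andP[ij mA].
have lt := total_weight_shift ij AF mA.
have [||| F' [F'k F'U cF' shF']] := IH (shift_fam i j F).
- by apply: leq_trans lt _.
- exact: shift_fam_uniform.
- exact: shift_fam_propU.
by exists F'; split; rewrite // cF' card_shift_fam.
Qed.

(** * Shadows and matchings *)

(** Only [Q 0, ..., Q s] matter; a constant [Q] gives ordinary matchings of size [s + 1]. The empty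
    set may be repeated, being disjoint from itself. *)
Definition rainbow_matching (T : finType) (s : nat)
    (Q : nat -> {set {set T}}) : Prop :=
  exists D : 'I_s.+1 -> {set T},
    (forall i, D i \in Q i) /\ (forall i j, i != j -> [disjoint D i & D j]).

Lemma card_disjoint_bigcup (I T : finType) (D : I -> {set T}) :
  (forall i j, i != j -> [disjoint D i & D j]) ->
  #|\bigcup_i D i| = \sum_i #|D i|.
Proof.
move=> dD; rewrite -sum1_card (partition_disjoint_bigcup _ _ dD).
by apply: eq_bigr => i _; rewrite sum1_card.
Qed.

Lemma card_initseg m b : b <= m -> #|initseg m b| = b.
Proof.
move=> bm; have -> : initseg m b = [set widen_ord bm x | x in 'I_b].
  apply/setP=> x; rewrite inE; apply/idP/imsetP => [xb|[y _ ->]] //=.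
  by exists (Ordinal xb) => //; apply: val_inj.
rewrite card_imset ?card_ord // => x y /(congr1 val) /= e; exact: val_inj.
Qed.

Definition shadow (T : finType) (G : {set {set T}}) : {set {set T}} :=
  [set D : {set T} | [exists x, (x \notin D) && (x |: D \in G)]].

(** Count pairs [x] in [A]: removing [x] gives a shadow member, which has [k - 1] elements and so at
    most [b - (k - 1)] extensions inside the first [b] points. *)
Lemma shadow_double_count m k b (G : {set {set 'I_m}}) :
  b <= m -> G \subset ksubsets m k ->
  (forall A, A \in G -> A \subset initseg m b) ->
  k * #|G| <= #|shadow G| * (b - k.-1).
Proof.
move=> bm Gk Gb.
have sz A : A \in G -> #|A| = k.
  by move/(subsetP Gk); rewrite inE => /eqP.
have -> : k * #|G| = \sum_(x : 'I_m) #|[set A in G | x \in A]|.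
  have -> : \sum_(x : 'I_m) #|[set A in G | x \in A]| =
            \sum_(x : 'I_m) \sum_(A in G) (x \in A : nat).
    apply: eq_bigr => x _; rewrite -sum1_card big_mkcond /= [RHS]big_mkcond /=.
    by apply: eq_bigr => A _; rewrite inE; case: (A \in G); case: (x \in A).
  rewrite exchange_big /= mulnC -sum_nat_const; apply: eq_bigr => A AG.
  by rewrite -(sz _ AG) -sum1_card big_mkcond; apply: eq_bigr => x _; case: ifP.
have -> : #|shadow G| * (b - k.-1) = \sum_(D in shadow G) (b - k.-1).
  by rewrite sum_nat_const.
apply: (@leq_trans (\sum_(x : 'I_m)
    #|[set D in shadow G | x \in initseg m b :\: D]|)).
  apply: leq_sum => x _.
  have <- : #|[set A :\ x | A in [set A in G | x \in A]]| =
            #|[set A in G | x \in A]|.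
    apply: card_in_imset => A B; rewrite !inE => /andP[_ xA] /andP[_ xB] e.
    by rewrite -(setD1K xA) e setD1K.
  apply/subset_leq_card/subsetP=> _ /imsetP[A /[!inE] /andP[AG xA] ->].
  rewrite !inE eqxx /= -(in_set (fun i : 'I_m => i < b)).
  rewrite (subsetP (Gb _ AG)) // andbT; apply/existsP; exists x.
  by rewrite !inE eqxx setD1K.
have -> : \sum_(x : 'I_m) #|[set D in shadow G | x \in initseg m b :\: D]| =
    \sum_(x : 'I_m) \sum_(D in shadow G) (x \in initseg m b :\: D : nat).
  apply: eq_bigr => x _; rewrite -sum1_card big_mkcond /= [RHS]big_mkcond /=.
  apply: eq_bigr => D _; rewrite inE.
  by case: (D \in shadow G); case: (x \in _ :\: _).
rewrite exchange_big /=; apply: leq_sum => D.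
rewrite inE => /existsP[y /andP[yD yDG]].
have <- : #|initseg m b :\: D| = \sum_(x : 'I_m) (x \in initseg m b :\: D : nat).
  by rewrite -sum1_card big_mkcond; apply: eq_bigr => x _; case: ifP.
have Db : D \subset initseg m b by rewrite (subset_trans _ (Gb _ yDG)) ?subsetUr.
rewrite cardsD (setIidPr Db) card_initseg //.
by have := sz _ yDG; rewrite cardsU1 yD => <-.
Qed.

(* Frankl's shadow theorem. Below [b = (s + 1) k] double counting suffices;
   above it a matching in the link of the last element has room to be extended,
   by shiftedness, to a matching in [G] itself. *)
Lemma shadow_bound m s b k (G : {set {set 'I_m}}) :
  b <= m -> G \subset ksubsets m k ->
  (forall A, A \in G -> A \subset initseg m b) ->
  left_shifted G -> ~ rainbow_matching s (fun=> G) ->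
  #|G| <= s * #|shadow G|.
Proof.
elim: b k G => [|b IH] k G bm Gk Gb Gs Gm.
all: have sz A : A \in G -> #|A| = k
  by move/(subsetP Gk); rewrite inE => /eqP.
(* For [k = 0] a member would be empty, and its repetition a matching. *)
all: have [k0|kpos] := posnP k;
  first by (have -> : G = set0; rewrite ?cards0 //; apply/eqP;
    apply: contra_notT Gm => /set0Pn[A AG]; exists (fun=> A); split=> // i j _;
    have /eqP := sz _ AG; rewrite k0 cards_eq0 => /eqP ->;
    rewrite -setI_eq0 set0I).
  have := shadow_double_count bm Gk Gb; rewrite sub0n muln0 leqn0 muln_eq0.
  by rewrite eqn0Ngt kpos /= => /eqP ->.
have [small|big] := ltnP b.+1 (s.+1 * k).
  have := shadow_double_count bm Gk Gb.
  have le : b.+1 - k.-1 <= s * k by nia.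
  move=> h; have := leq_trans h (leq_mul (leqnn _) le).
  rewrite mulnA [leqRHS]mulnC leq_pmul2l //; by rewrite mulnC.
pose x : 'I_m := Ordinal bm.
pose G0 := [set A in G | x \notin A].
pose G1 := [set A : {set 'I_m} | (x \notin A) && (x |: A \in G)].
have cG : #|G| = #|G0| + #|G1|.
  rewrite -(cardsID [set A : {set 'I_m} | x \notin A] G); congr addn.
    by apply: eq_card => A; rewrite !inE.
  have -> : G :\: [set A : {set 'I_m} | x \notin A] = [set x |: A | A in G1].
    apply/setP=> A; rewrite !inE negbK; apply/andP/imsetP => [[xA AG]|[B]].
      by exists (A :\ x); rewrite ?inE ?eqxx setD1K.
    by rewrite inE => /andP[_ BG ->]; rewrite !inE eqxx.
  apply: card_in_imset => A B; rewrite !inE => /andP[xA _] /andP[xB _] e.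
  by rewrite -(setU1K xA) e setU1K.
(* Shadow members of [G0] avoid [x]; those of [G1], enlarged by [x], contain it. Both kinds lie in
   the shadow of [G]. *)
have cS : #|shadow G0| + #|shadow G1| <= #|shadow G|.
  rewrite -(cardsID [set A : {set 'I_m} | x \notin A] (shadow G)).
  apply: leq_add.
    apply/subset_leq_card/subsetP=> D; rewrite !inE => /existsP[y].
    rewrite !inE negb_or => /and3P[yD yG /andP[_ xD]]; rewrite xD andbT.
    by apply/existsP; exists y; rewrite yD.
  have <- : #|[set x |: D | D in shadow G1]| = #|shadow G1|.
    apply: card_in_imset => A B; rewrite !inE => /existsP[y].
    rewrite !inE negb_or -andbA => /and4P[_ _ xA _] /existsP[z].
    rewrite !inE negb_or -andbA => /and4P[_ _ xB _] e.
    by rewrite -(setU1K xA) e setU1K.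
  apply/subset_leq_card/subsetP=> _ /imsetP[D /[!inE] /existsP[y] + ->].
  rewrite !inE negb_or -andbA => /and4P[yD xy xD yxD].
  rewrite eqxx /=; apply/existsP; exists y.
  by rewrite !inE negb_or eq_sym xy yD setUCA.
rewrite cG; apply: leq_trans (leq_mul (leqnn s) cS); rewrite mulnDr.
have ltb (A : {set 'I_m}) (y : 'I_m) :
    x \notin A -> A \subset initseg m b.+1 -> y \in A -> y < b.
  move=> xA /subsetP Ab yA; have := Ab _ yA; rewrite inE ltnS leq_eqVlt.
  case/predU1P=> // yb; case/negP: xA.
  by have <- : y = x by apply: val_inj.
apply: leq_add.
  apply: (IH k) => //; first exact: ltnW.
  - by apply/subsetP=> A /[!inE] /andP[/sz -> _].
  - move=> A /[!inE] /andP[AG xA]; apply/subsetP=> y yA.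
    by rewrite inE (ltb A) // Gb.
  - move=> A i j; rewrite !inE negb_or => /andP[AG xA] ij jA iA.
    rewrite Gs //= (negPf xA) andbF andbT.
    apply: contraTneq ij => <-; rewrite -leqNgt ltnW // (ltb A) //; exact: Gb.
  - case=> D [DG dD]; apply: Gm; exists D; split=> // i.
    by have := DG i; rewrite inE => /andP[].
have szG1 A : A \in G1 -> #|A| = k.-1.
  by rewrite inE => /andP[xA /sz]; rewrite cardsU1 xA => <-.
have G1b A : A \in G1 -> A \subset initseg m b.
  rewrite inE => /andP[xA xAG]; apply/subsetP=> y yA; rewrite inE (ltb A) //.
  by apply: subset_trans (Gb _ xAG); rewrite subsetUr.
apply: (IH k.-1) => //; first exact: ltnW.
- by apply/subsetP=> A /szG1; rewrite inE => ->.
- move=> A i j AG1 ij jA iA; have := AG1; rewrite !inE => /andP[xA xAG].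
  have jb : j < b by have := subsetP (G1b _ AG1) _ jA; rewrite inE.
  have xi : x != i by apply: contraTneq ij => <-; rewrite -leqNgt ltnW.
  have xj : x != j by apply: contraTneq jb => <-; rewrite ltnn.
  rewrite (negPf xi) (negPf xA) andbF /=.
  have := Gs _ i j xAG ij; rewrite !inE jA orbT negb_or eq_sym xi iA.
  move=> /(_ isT isT); congr (_ \in G); apply/setP=> y; rewrite !inE.
  by case: (eqVneq y x) => [->|] //=; rewrite xj /= orbT.
case=> D [DG dD]; apply: Gm.
(* The [D i] cover [(s + 1)(k - 1)] of at least [(s + 1) k] points, so [s + 1] distinct points stay
   free; by shiftedness each can stand in for [x] in [x |: D i]. *)
pose R := initseg m b.+1 :\: \bigcup_i D i.
have cR : s < #|R|.
  have Dk : \sum_(i < s.+1) #|D i| = s.+1 * k.-1.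
    rewrite (eq_bigr (fun=> k.-1)); last by move=> i _; rewrite szG1.
    by rewrite sum_nat_const card_ord.
  rewrite cardsD card_initseg //.
  have := subset_leq_card (subsetIr (initseg m b.+1) (\bigcup_i D i)).
  rewrite card_disjoint_bigcup // Dk; nia.
pose e (i : 'I_s.+1) : 'I_m := enum_val (widen_ord cR i).
have eR i : e i \in R by apply: enum_valP.
have eI : injective e.
  by move=> i j /enum_val_inj /(congr1 val) /= ij; apply: val_inj.
have eD i j : e i \notin D j.
  have := eR i; rewrite !inE => /andP[+ _]; apply: contraNN => eij.
  by apply/bigcupP; exists j.
exists (fun i => e i |: D i); split=> [i|i j ij].
  have := DG i; rewrite inE => /andP[xD xDG].
  have [->//|ex] := eqVneq (e i) x.
  have ei : e i < x.
    have := eR i; rewrite !inE => /andP[_]; rewrite ltnS leq_eqVlt.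
    by case/predU1P => // eb; case/eqP: ex; apply: val_inj.
  have := Gs _ _ x xDG ei; rewrite /swap_elt setU1K // !inE eqxx negb_or ex eD.
  exact.
rewrite -setI_eq0; apply/eqP/setP=> y; rewrite !inE.
have /pred0P/(_ y)/= := dD _ _ ij.
case: (eqVneq y (e i)) => [->|_] /=; last case: (eqVneq y (e j)) => [->|_] //=.
  by rewrite (negPf (eD i j)) orbF (inj_eq eI) (negPf ij).
by rewrite (negPf (eD j i)).
Qed.

(** * Nested sets of positions on a circle *)

(** Greedy choice: only [i] elements are taken when [q i] is reached. *)
Lemma distinct_representatives (T : finType) s (q : nat -> {set T}) :
  (forall i, i <= s -> i < #|q i|) ->
  exists a : nat -> T, (forall i, i <= s -> a i \in q i) /\
    (forall i j, i <= s -> j <= s -> i != j -> a i != a j).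
Proof.
elim: s => [|s IH] lq.
  have /card_gt0P[x xq] := lq 0 (leqnn 0).
  exists (fun=> x); split=> [i|i j]; rewrite !leqn0; first by move/eqP->.
  by move=> /eqP-> /eqP->; rewrite eqxx.
have [i is_|a [aq aI]] := IH; first exact: lq (leqW is_).
pose A := [set a i | i : 'I_s.+1].
have /card_gt0P[x] : 0 < #|q s.+1 :\: A|.
  rewrite cardsD subn_gt0; apply: leq_ltn_trans (lq _ (leqnn _)).
  apply: leq_trans (subset_leq_card (subsetIr _ _)) _.
  by rewrite -[leqRHS](card_ord s.+1) leq_imset_card.
rewrite inE => /andP[xA xq].
have ax i : i <= s -> a i != x.
  move=> is_; apply: contraNneq xA => <-; apply/imsetP.
  by exists (Ordinal (is_ : i < s.+1)).
exists (fun i => if i == s.+1 then x else a i).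
split=> [i|i j]; first by case: eqP => [->//|] ? ?; apply: aq; lia.
move=> iS jS ij; case: (eqVneq i s.+1) => [ei|ni];
  case: (eqVneq j s.+1) => [ej|nj].
- by rewrite ei ej eqxx in ij.
- by rewrite eq_sym ax //; lia.
- by rewrite ax //; lia.
- by apply: aI => //; lia.
Qed.

(** The greedy choice fails, so [#|q i| <= i] for some [i <= s]. By nesting [#|q 0| <= i], and each
    of [q 1, ..., q i] misses at least [#|T| - s] elements. *)
Lemma nested_without_representatives (T : finType) s (q : nat -> {set T}) :
  s <= #|T| -> (forall i, i < s -> q i \subset q i.+1) ->
  ~ (exists a : nat -> T, (forall i, i <= s -> a i \in q i) /\
      (forall i j, i <= s -> j <= s -> i != j -> a i != a j)) ->
  #|q 0| <= s /\ (#|T| - s) * #|q 0| <= \sum_(i < s) #|~: q i.+1|.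
Proof.
move=> sT nest noSDR.
have mono i j : i <= j -> j <= s -> #|q i| <= #|q j|.
  elim: j => [|j IH]; first by rewrite leqn0 => /eqP->.
  rewrite leq_eqVlt => /predU1P[->//|ij] js.
  exact: leq_trans (IH ij (ltnW js)) (subset_leq_card (nest _ js)).
have [/forallP big|] := boolP [forall i : 'I_s.+1, i < #|q i|].
  by case: noSDR; apply: distinct_representatives => i is_;
     apply: (big (Ordinal (is_ : i < s.+1))).
rewrite negb_forall => /existsP[[i /= is_]]; rewrite -leqNgt => qi.
have q0 : #|q 0| <= i by apply: leq_trans qi; apply: mono.
split; first exact: leq_trans q0 _.
apply: (@leq_trans (\sum_(j < s | j < i) (#|T| - s))).
  rewrite (big_ord_narrow (is_ : i <= s)) sum_nat_const card_ord mulnC leq_mul2r q0.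
  by rewrite orbT.
rewrite big_mkcond /=; apply: leq_sum => j _; case: ifP => // ji.
rewrite cardsCs setCK; apply: leq_sub2l.
by apply: leq_trans (leq_trans (mono _ _ ji is_) qi) _.
Qed.

Lemma card_ord_interval m u v :
  #|[set x : 'I_m | u <= x < v]| = minn v m - u.
Proof.
have -> : [set x : 'I_m | u <= x < v] =
          initseg m (minn v m) :\: initseg m (minn u (minn v m)).
  by apply/setP=> x; rewrite !inE; have := ltn_ord x; lia.
rewrite cardsD (setIidPr _); last by apply/subsetP=> x; rewrite !inE; lia.
by rewrite !card_initseg; lia.
Qed.

Lemma card_set_take (T : finType) (A : {set T}) c :
  c <= #|A| -> #|[set x in take c (enum A)]| = c.
Proof.
move=> cA; rewrite cardsE; have/card_uniqP-> := take_uniq c (enum_uniq A).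
by rewrite size_takel // -cardE.
Qed.

Lemma sorted_enum_set m (E : {set 'I_m}) : sorted ltn (map val (enum E)).
Proof.
rewrite sorted_map; apply: sorted_filter; first by move=> a b c; apply: ltn_trans.
by rewrite -enumT -(@sorted_map _ _ val) val_enum_ord iota_ltn_sorted.
Qed.

Lemma sorted_ltn_gap (v : seq nat) i d :
  sorted ltn v -> i + d < size v -> nth 0 v i + d <= nth 0 v (i + d).
Proof.
move=> sv; elim: d => [|d IH]; first by rewrite !addn0.
rewrite !addnS => lt; have := IH (ltnW lt).
suff : nth 0 v (i + d) < nth 0 v (i + d).+1 by lia.
by apply: (sorted_ltn_nth ltn_trans) => //; rewrite inE; lia.
Qed.

(** On a circle of [m] positions both gaps between [a] and [b] are at least [l], so that arcs of
    length [l] starting there are disjoint. *)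
Definition circ_sep (m l a b : nat) : bool :=
  ((a + l <= b) && (b + l <= a + m)) || ((b + l <= a) && (a + l <= b + m)).

Lemma card_not_circ_sep m l (a : 'I_m) :
  #|[set b : 'I_m | ~~ circ_sep m l a b]| <= l.*2.
Proof.
(* The window around [a], then its parts wrapping past the last and past the first position. *)
pose I1 := [set b : 'I_m | a.+1 - l <= b < a + l].
pose I2 := [set b : 'I_m | 0 <= b < a + l - m].
pose I3 := [set b : 'I_m | (a + m).+1 - l <= b < m].
apply: (@leq_trans (#|I1| + #|I2| + #|I3|)).
  apply: leq_trans (leq_add (leq_card_setU _ _) (leqnn _)).
  apply: leq_trans (leq_card_setU _ _).
  apply/subset_leq_card/subsetP=> b; rewrite !inE /circ_sep.
  by have := ltn_ord b; have := ltn_ord a; lia.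
by rewrite !card_ord_interval; have := ltn_ord a; lia.
Qed.

Section EnumClasses.
Variables (m l t : nat) (E : {set 'I_m}) (x0 : 'I_m).
Hypotheses (l_gt0 : 0 < l) (cE : #|E| = t * l).

Definition enum_class (c : 'I_l) (i : 'I_t) : 'I_m := nth x0 (enum E) (i * l + c).

Lemma enum_class_index (c : 'I_l) (i : 'I_t) : i * l + c < size (enum E).
Proof.
rewrite -cardE cE; have := ltn_ord c; have := ltn_ord i; nia.
Qed.

(** Positions differ at least as much as ranks, and ranks in one class differ by multiples of [l].
    As there are [t * l] ranks, the gap around the end is also at least [l]. *)
Lemma enum_class_sep c i j : i != j ->
  circ_sep m l (enum_class c i) (enum_class c j).
Proof.
have sep : forall i j : 'I_t, i < j ->
    circ_sep m l (enum_class c i) (enum_class c j).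
  move=> {}i {}j ij; have szE : size (enum E) = t * l by rewrite -cardE.
  have nv k : k < t * l -> nth 0 (map val (enum E)) k = nth x0 (enum E) k.
    by move=> kt; rewrite (nth_map x0) ?szE.
  have gap d e : d + e < t * l ->
      nth x0 (enum E) d + e <= nth x0 (enum E) (d + e).
    move=> de; rewrite -!nv //; last lia.
    by apply: sorted_ltn_gap; rewrite ?sorted_enum_set // size_map szE.
  have hi := enum_class_index c i; have hj := enum_class_index c j.
  rewrite szE in hi hj.
  have jil : i * l + l <= j * l by rewrite -mulSnr leq_mul2r ij orbT.
  have tjl : j * l + l <= t * l by rewrite -mulSnr leq_mul2r ltn_ord orbT.
  have cl := ltn_ord c.
  have g1 := gap (i * l + c) (j * l - i * l).
  have g2 := gap 0 (i * l + c).
  have g3 := gap (j * l + c) (t * l - (j * l + c) - 1).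
  have lt := ltn_ord (nth x0 (enum E) (t * l - 1)).
  have e1 : i * l + c + (j * l - i * l) = j * l + c by lia.
  have e3 : j * l + c + (t * l - (j * l + c) - 1) = t * l - 1 by lia.
  rewrite e1 in g1; rewrite add0n in g2; rewrite e3 in g3.
  rewrite /circ_sep /enum_class; apply/orP; left.
  by have := g1 hj; have := g2 hi; have := g3 ltac:(lia); lia.
case: (ltngtP i j) => [ij _|ji _|/val_inj-> /eqP//]; first exact: sep.
by have := sep _ _ ji; rewrite /circ_sep orbC.
Qed.

Lemma card_enum_class (Q : {set 'I_m}) : Q \subset E ->
  #|Q| = \sum_(c < l) #|[set i | enum_class c i \in Q]|.
Proof.
move=> /setIidPr QE.
have -> : #|Q| = \sum_(x in E) (x \in Q : nat).
  rewrite -{1}QE -sum1_card big_mkcond [RHS]big_mkcond; apply: eq_bigr => x _.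
  by rewrite inE; case: (x \in E); case: (x \in Q).
rewrite -big_enum /= (big_nth x0) -cardE cE big_nat_mul big_mkord.
transitivity (\sum_(i < t) \sum_(c < l) (enum_class c i \in Q : nat)).
  apply: eq_bigr => i _; rewrite -{1}[i * l]add0n mulSnr big_addn addKn big_mkord.
  by apply: eq_bigr => c _; rewrite addnC.
rewrite exchange_big; apply: eq_bigr => c _ /=.
by rewrite -sum1_card [RHS]big_mkcond; apply: eq_bigr => i _; rewrite inE; case: ifP.
Qed.
End EnumClasses.

(* With [m = t * l + rho], discard [rho] positions outside the largest set
   [Q s]; enumerating the other [t * l] positions around the circle, each
   residue class of ranks mod [l] consists of [t] pairwise separated
   positions. When fewer than [rho] positions avoid [Q s], a separated system
   for [Q 0, ..., Q s.-1] always extends to [Q s], so that [s] can be lowered. *)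
Lemma circle_bound m l s (Q : nat -> {set 'I_m}) :
  0 < l -> s.*2.+1 * l <= m -> (forall i, i < s -> Q i \subset Q i.+1) ->
  ~ (exists a : nat -> 'I_m, (forall i, i <= s -> a i \in Q i) /\
      (forall i j, i <= s -> j <= s -> i != j -> circ_sep m l (a i) (a j))) ->
  (m - s * l) * #|Q 0| <= l * \sum_(i < s) #|~: Q i.+1|.
Proof.
move=> l0; elim: s => [|s IH] lm nest noSep.
  have -> : Q 0 = set0; last by rewrite cards0 muln0.
  apply/eqP; apply: contra_notT noSep => /set0Pn[x xQ].
  exists (fun=> x); split=> [i|i j]; rewrite !leqn0; first by move/eqP->.
  by move=> /eqP-> /eqP->; rewrite eqxx.
have [few|many] := ltnP #|~: Q s.+1| (m %% l).
  have hs : s.*2.+1 * l <= m by apply: leq_trans lm; rewrite leq_mul2r; lia.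
  apply: (@leq_trans ((m - s * l) * #|Q 0|)); first by rewrite leq_mul2r; lia.
  apply: (@leq_trans (l * \sum_(i < s) #|~: Q i.+1|)); last first.
    by rewrite leq_mul2l big_ord_recr leq_addr orbT.
  apply: IH => // [i is_|[a [aQ aS]]]; first exact: nest (leqW is_).
  apply: noSep.
  (* Each chosen position excludes at most [2 l] others, while [Q s.+1] has more than
     [m - l >= 2 l (s + 1)] positions. *)
  pose bad := \bigcup_(i < s.+1) [set b : 'I_m | ~~ circ_sep m l (a i) b].
  have cbad : #|bad| <= s.+1 * l.*2.
    rewrite -[s.+1]card_ord -sum_nat_const /bad.
    elim/big_ind2: _ => [|A1 n1 A2 n2 h1 h2|i _]; first by rewrite cards0.
      exact: leq_trans (leq_card_setU _ _) (leq_add h1 h2).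
    exact: card_not_circ_sep.
  have /card_gt0P[x] : 0 < #|Q s.+1 :\: bad|.
    rewrite cardsD subn_gt0.
    have h1 := leq_trans (subset_leq_card (subsetIr (Q s.+1) bad)) cbad.
    have h2 : m < #|Q s.+1| + l.
      rewrite -[m in m < _]card_ord -(cardsC (Q s.+1)) ltn_add2l.
      exact: ltn_trans few (ltn_pmod _ l0).
    have h3 : s.+1 * l.*2 + l <= m.
      by apply: leq_trans lm; rewrite [leqRHS]mulSn addnC -doubleMl -doubleMr.
    rewrite -(ltn_add2r l); apply: leq_ltn_trans h2; apply: leq_trans h3.
    by rewrite leq_add2r.
  rewrite inE => /andP[xbad xQ].
  have ax i : i <= s -> circ_sep m l (a i) x.
    move=> is_; apply: contraNT xbad => sep; apply/bigcupP.
    by exists (Ordinal (is_ : i < s.+1)); rewrite ?inE.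
  exists (fun i => if i == s.+1 then x else a i); split=> [i|i j].
    by case: eqP => [->//|] ? ?; apply: aQ; lia.
  move=> iS jS ij; case: (eqVneq i s.+1) => [ei|ni];
    case: (eqVneq j s.+1) => [ej|nj].
  - by rewrite ei ej eqxx in ij.
  - by have := ax j ltac:(lia); rewrite /circ_sep orbC.
  - by apply: ax; lia.
  - by apply: aS => //; lia.
set t := m %/ l; set rho := m %% l in many.
have dm : m = t * l + rho by apply: divn_eq.
have m0 : 0 < m by apply: leq_trans lm; rewrite muln_gt0 l0.
have ts : s.+1 <= t by rewrite leq_divRL // (leq_trans _ lm) // leq_mul2r; lia.
pose E := ~: [set x in take rho (enum (~: Q s.+1))].
have cE : #|E| = t * l.
  by have := cardsC E; rewrite setCK card_set_take // card_ord; lia.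
have sub i : i <= s.+1 -> Q i \subset E.
  move=> is_; apply: (@subset_trans _ _ (Q s.+1)).
    have [k] := ubnP (s.+1 - i); elim: k i is_ => // k IHk i is_ lt.
    have [->//|ne] := eqVneq i s.+1.
    have lti : i < s.+1 by rewrite ltn_neqAle ne.
    by apply: subset_trans (nest _ lti) (IHk _ lti _); lia.
  apply/subsetP=> x xQ; rewrite !inE; apply: contraL xQ => /mem_take.
  by rewrite mem_enum inE.
pose q (c : 'I_l) i := [set k : 'I_t | enum_class E (Ordinal m0) c k \in Q i].
have cl (c : 'I_l) : #|q c 0| <= s.+1 /\
    (t - s.+1) * #|q c 0| <= \sum_(i < s.+1) #|~: q c i.+1|.
  rewrite -[t in t - _]card_ord; apply: nested_without_representatives.
  - by rewrite card_ord.
  - by move=> i lti; apply/subsetP=> k; rewrite !inE; apply/subsetP/nest.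
  case=> a [aq aI]; apply: noSep.
  exists (fun i => enum_class E (Ordinal m0) c (a i)); split=> [i is_|i j is_ js ij].
    by have := aq _ is_; rewrite inE.
  by apply: enum_class_sep => //; apply: aI.
have cQ i : i <= s.+1 -> #|Q i| = \sum_(c < l) #|q c i|.
  by move=> is_; apply: card_enum_class (sub _ is_).
have Q0 : #|Q 0| <= l * s.+1.
  rewrite cQ // -[l in l * _]card_ord -sum_nat_const; apply: leq_sum => c _.
  by case: (cl c).
have cQC i : i < s.+1 -> #|~: Q i.+1| = rho + \sum_(c < l) #|~: q c i.+1|.
  move=> is_; have := cardsC (Q i.+1); rewrite card_ord (cQ _ is_).
  have : \sum_(c < l) #|q c i.+1| + \sum_(c < l) #|~: q c i.+1| = t * l.
    rewrite -big_split /= (eq_bigr (fun=> t)); last first.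
      by move=> c _; rewrite cardsC card_ord.
    by rewrite sum_nat_const card_ord mulnC.
  by lia.
rewrite (eq_bigr (fun i : 'I_s.+1 => rho + \sum_(c < l) #|~: q c i.+1|));
  last by move=> i _; apply: cQC.
rewrite big_split /= sum_nat_const card_ord exchange_big /=.
set Z := \sum_(c < l) _.
have hZ : (t - s.+1) * #|Q 0| <= Z.
  by rewrite cQ // big_distrr /=; apply: leq_sum => c _; case: (cl c).
(* The classes pay for the first summand; the [rho] discarded positions, outside every [Q i.+1], pay
   for the second, since [#|Q 0| <= l * s.+1]. *)
have -> : m - s.+1 * l = (t - s.+1) * l + rho.
  rewrite mulnBl {1}dm.
  have : s.+1 * l <= t * l by rewrite leq_mul2r ts orbT.
  by lia.
rewrite mulnDl mulnDr addnC leq_add //.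
  by rewrite [rho * _]mulnC mulnA leq_mul2r Q0 orbT.
by rewrite mulnAC mulnC leq_mul2l hZ orbT.
Qed.

(** * Nested families without a rainbow matching *)

(** The second disjunct is the part that wraps past the last position. *)
Definition arc (m l : nat) (a : 'I_m) : {set 'I_m} :=
  [set x : 'I_m | (a <= x < a + l) || (x + m < a + l)].

Lemma card_arc m l (a : 'I_m) : l <= m -> #|arc l a| = l.
Proof.
move=> lm; have -> : arc l a =
    [set x : 'I_m | a <= x < a + l] :|: [set x : 'I_m | 0 <= x < a + l - m].
  by apply/setP=> x; rewrite !inE; lia.
rewrite cardsU (_ : _ :&: _ = set0) ?cards0 ?card_ord_interval.
  by have := ltn_ord a; lia.
by apply/setP=> x; rewrite !inE; lia.
Qed.

Lemma disjoint_arc m l (a b : 'I_m) :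
  circ_sep m l a b -> [disjoint arc l a & arc l b].
Proof.
rewrite /circ_sep -setI_eq0 => sep; apply/eqP/setP=> x; rewrite !inE.
by have := ltn_ord x; have := ltn_ord a; have := ltn_ord b; lia.
Qed.

Lemma perm_imset_eq_card (T : finType) (A B : {set T}) :
  #|A| = #|B| -> exists u : {perm T}, u @: A = B.
Proof.
move=> cAB.
(* [A] followed by its complement is sent, rank by rank, to [B] followed by its complement. *)
pose f := [fun x => nth x (enum B ++ enum (~: B))
                        (index x (enum A ++ enum (~: A)))].
have sz (C : {set T}) : size (enum C ++ enum (~: C)) = #|T|.
  by rewrite size_cat -!cardE cardsC.
have all_in (C : {set T}) x : x \in enum C ++ enum (~: C).
  by rewrite mem_cat !mem_enum inE orbN.
have un (C : {set T}) : uniq (enum C ++ enum (~: C)).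
  rewrite cat_uniq !enum_uniq andbT /=; apply/hasPn => x.
  by rewrite !mem_enum inE.
have ilt (C : {set T}) x : index x (enum C ++ enum (~: C)) < #|T|.
  by rewrite -(sz C) index_mem.
have fI : injective f.
  move=> x y /=; rewrite (set_nth_default y) ?sz // => /eqP.
  rewrite nth_uniq ?sz // => /eqP e.
  by rewrite -(nth_index x (all_in A x)) e nth_index.
exists (perm fI); apply/eqP; rewrite eqEcard card_imset; last exact: perm_inj.
rewrite cAB leqnn andbT; apply/subsetP=> _ /imsetP[x xA ->].
have xE : x \in enum A by rewrite mem_enum.
have iB : index x (enum A) < size (enum B) by rewrite -cardE -cAB cardE index_mem.
by rewrite permE /= index_cat xE nth_cat iB -(mem_enum B) mem_nth.
Qed.

Lemma imset_permM (T : finType) (u v : {perm T}) (A : {set T}) :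
  (u * v)%g @: A = v @: (u @: A).
Proof. by rewrite -imset_comp; apply: eq_imset => x; rewrite /= permM. Qed.

(** Katona's averaging: by symmetry each [l]-set is the image of an arc for the same number [c] of
    pairs of a permutation and a starting point. *)
Lemma sum_perm_arcs m l : 0 < m -> l <= m ->
  exists2 c, 0 < c & forall Q : {set {set 'I_m}}, Q \subset ksubsets m l ->
    \sum_(u : {perm 'I_m}) #|[set a | u @: arc l a \in Q]| = c * #|Q|.
Proof.
move=> m0 lm.
pose N (D : {set 'I_m}) :=
  \sum_(u : {perm 'I_m}) \sum_(a < m) (u @: arc l a == D : nat).
pose D0 := arc l (Ordinal m0).
exists (N D0) => [|Q Ql].
  rewrite /N (bigD1 1%g) //= (bigD1 (Ordinal m0)) //=.
  suff -> : (1%g : {perm 'I_m}) @: arc l (Ordinal m0) == D0 by [].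
  by rewrite (eq_imset _ (@perm1 _)) imset_id.
have ND D : D \in Q -> N D = N D0.
  move=> DQ; have [|v vD] := @perm_imset_eq_card _ D0 D.
    by have := subsetP Ql _ DQ; rewrite inE => /eqP ->; rewrite card_arc.
  rewrite /N (reindex_inj (mulIg v)) /=; apply: eq_bigr => u _.
  apply: eq_bigr => a _; rewrite imset_permM -vD.
  by rewrite (inj_eq (imset_inj (@perm_inj _ v))).
transitivity (\sum_(D in Q) N D); last first.
  by rewrite (eq_bigr _ ND) sum_nat_const mulnC.
rewrite /N exchange_big /=; apply: eq_bigr => u _.
rewrite exchange_big /= -sum1_card big_mkcond /=; apply: eq_bigr => a _.
rewrite inE; case: ifP => [uQ|uQ].
  rewrite (bigD1 (u @: arc l a)) //= eqxx big1 // => D /andP[_].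
  by rewrite eq_sym => /negPf->.
by rewrite big1 // => D DQ; case: eqP DQ uQ => // ->  ->.
Qed.

(** For each permutation the circle bound applies to the starting points of arcs with image in
    [Q i], since separated arcs have disjoint images; then sum over permutations. *)
Lemma nested_families_bound m l s (Q : nat -> {set {set 'I_m}}) :
  0 < l -> s.*2.+1 * l <= m -> Q 0 \subset ksubsets m l ->
  (forall i, i < s -> Q i \subset Q i.+1) -> ~ rainbow_matching s Q ->
  (m - s * l) * #|Q 0| <= l * \sum_(i < s) #|ksubsets m l :\: Q i.+1|.
Proof.
move=> l0 lm Q0l nest noQ.
have llm : l <= m by apply: leq_trans lm; rewrite leq_pmull.
have m0 : 0 < m by apply: leq_trans llm.
have [c c0 avg] := sum_perm_arcs m0 llm.
rewrite -(leq_pmul2l c0) mulnCA -avg // [leqRHS]mulnCA [c * _]big_distrr /=.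
rewrite (eq_bigr (fun i : 'I_s => \sum_(u : {perm 'I_m})
    #|~: [set a | u @: arc l a \in Q i.+1]|)); last first.
  move=> i _; rewrite -avg ?subsetDl //; apply: eq_bigr => u _.
  apply: eq_card => a; rewrite !inE card_imset; last exact: perm_inj.
  by rewrite card_arc // eqxx andbT.
rewrite exchange_big /= !big_distrr /=; apply: leq_sum => u _.
apply: (@circle_bound m l s (fun i => [set a | u @: arc l a \in Q i])) => //.
  by move=> i lti; apply/subsetP=> a; rewrite !inE; apply/subsetP/nest.
case=> a [aQ aS]; apply: noQ.
exists (fun i : 'I_s.+1 => u @: arc l (a i)); split=> [i|i j ij].
  by have := aQ i (ltn_ord i : i <= s); rewrite inE.
rewrite -setI_eq0 -imsetI; last by move=> x y _ _; apply: perm_inj.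
rewrite imset_eq0 setI_eq0 disjoint_arc //.
exact: aS (ltn_ord i) (ltn_ord j) ij.
Qed.

(** * Links *)

Definition join_set (a m : nat) (B : {set 'I_a}) (D : {set 'I_m}) :
    {set 'I_(a + m)} :=
  [set x | match split x with inl i => i \in B | inr j => j \in D end].

Lemma in_join_setl a m (B : {set 'I_a}) (D : {set 'I_m}) x :
  (lshift m x \in join_set B D) = (x \in B).
Proof. by rewrite inE (unsplitK (inl x)). Qed.

Lemma in_join_setr a m (B : {set 'I_a}) (D : {set 'I_m}) x :
  (rshift a x \in join_set B D) = (x \in D).
Proof. by rewrite inE (unsplitK (inr x)). Qed.

Definition in_join_set := (in_join_setl, in_join_setr).

Lemma eq_lrshift a m (i : 'I_a) (j : 'I_m) : (lshift m i == rshift a j) = false.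
Proof. by rewrite eq_sym eq_rlshift. Qed.

Lemma join_setP a m (A A' : {set 'I_(a + m)}) :
  (forall x, (lshift m x \in A) = (lshift m x \in A')) ->
  (forall x, (rshift a x \in A) = (rshift a x \in A')) -> A = A'.
Proof. by move=> hl hr; apply/setP=> x; case: (split_ordP x) => i ->. Qed.

Lemma join_set_surj a m (A : {set 'I_(a + m)}) :
  A = join_set [set x | lshift m x \in A] [set x | rshift a x \in A].
Proof. by apply: join_setP => x; rewrite in_join_set inE. Qed.

Lemma join_set_inj a m (B B' : {set 'I_a}) (D D' : {set 'I_m}) :
  join_set B D = join_set B' D' -> B = B' /\ D = D'.
Proof.
move=> e; split; apply/setP=> x; first by rewrite -(in_join_setl B D) e in_join_set.
by rewrite -(in_join_setr B D) e in_join_set.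
Qed.

Lemma card_join_set a m (B : {set 'I_a}) (D : {set 'I_m}) :
  #|join_set B D| = #|B| + #|D|.
Proof.
have -> : join_set B D = (lshift m @: B) :|: ([set rshift a x | x in D]).
  apply: join_setP => x; rewrite in_join_set inE.
    rewrite (mem_imset _ _ (@lshift_inj _ _)); case: imsetP; rewrite ?orbF //.
    by case=> y _ /eqP; rewrite eq_lrshift.
  rewrite (mem_imset _ _ (@rshift_inj _ _)); case: imsetP => //.
  by case=> y _ /eqP; rewrite eq_rlshift.
rewrite cardsU !card_imset; [|exact: rshift_inj|exact: lshift_inj].
rewrite (_ : _ :&: _ = set0) ?cards0 ?subn0 //; apply/eqP; rewrite setI_eq0.
apply/pred0P=> x /=; apply/negP=> /andP[/imsetP[i _ ->] /imsetP[j _ /eqP]].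
by rewrite eq_lrshift.
Qed.

Lemma bigcup_join_set (I : finType) a m (B : I -> {set 'I_a}) (D : I -> {set 'I_m}) :
  \bigcup_i join_set (B i) (D i) = join_set (\bigcup_i B i) (\bigcup_i D i).
Proof.
by apply: join_setP => x; rewrite in_join_set; apply/bigcupP/bigcupP => -[i _ h];
  exists i => //; move: h; rewrite in_join_set.
Qed.

(** The family [L B] of the overview, to be used with [a = p + 1]. *)
Definition link (a m : nat) (F : {set {set 'I_(a + m)}}) (B : {set 'I_a}) :
    {set {set 'I_m}} := [set D | join_set B D \in F].

Lemma card_sum_link a m (F : {set {set 'I_(a + m)}}) :
  #|F| = \sum_(B : {set 'I_a}) #|link F B|.
Proof.
pose J (q : {set 'I_a} * {set 'I_m}) := join_set q.1 q.2.
have JI : injective J by move=> [B D] [B' D'] /join_set_inj /= [-> ->].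
have FJ : F = J @: [set q | J q \in F].
  apply/setP=> A; apply/idP/imsetP => [AF|[q]]; last by rewrite inE => qF ->.
  exists ([set x | lshift m x \in A], [set x | rshift a x \in A]).
    by rewrite inE /J /= -join_set_surj.
  exact: join_set_surj.
rewrite [in LHS]FJ card_imset // -sum1_card big_mkcond /=.
transitivity (\sum_(B : {set 'I_a}) \sum_(D : {set 'I_m})
                (join_set B D \in F : nat)).
  by rewrite pair_bigA; apply: eq_bigr => q _; rewrite inE; case: ifP.
apply: eq_bigr => B _; rewrite -sum1_card [RHS]big_mkcond.
by apply: eq_bigr => D _; rewrite [D \in link _ _]inE; case: ifP.
Qed.

Lemma in_swap_elt (T : finType) (i j x : T) (A : {set T}) :
  (x \in swap_elt i j A) = (x == i) || (x != j) && (x \in A).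
Proof. by rewrite in_setU1 in_setD1. Qed.

Section LinkShift.
Variables (a m : nat) (F : {set {set 'I_(a + m)}}).
Hypothesis F_shifted : left_shifted F.

Lemma link_left_shifted B : left_shifted (link F B).
Proof.
move=> D i j; rewrite !inE => DF ij jD iD.
have := F_shifted DF (i := rshift a i) (j := rshift a j).
rewrite !in_join_set jD iD /= ltn_add2l ij => /(_ isT isT isT).
congr (_ \in F); apply: join_setP => x;
  rewrite ?in_swap_elt !in_join_set ?in_swap_elt ?in_setU1.
  by rewrite !eq_lrshift.
by rewrite !eq_rshift.
Qed.

(** Trading a tail element [x] for the head element [y] is a left shift. *)
Lemma shadow_link (B : {set 'I_a}) y :
  y \notin B -> shadow (link F B) \subset link F (y |: B).
Proof.
move=> yB; apply/subsetP=> D; rewrite !inE => /existsP[x]; rewrite inE.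
case/andP=> xD DF; have := F_shifted DF (i := lshift m y) (j := rshift a x).
rewrite !in_join_set setU11 yB /= ltn_addr ?ltn_ord // => /(_ isT isT isT).
congr (_ \in F); apply: join_setP => z;
  rewrite ?in_swap_elt !in_join_set ?in_swap_elt ?in_setU1.
  by rewrite eq_lshift eq_lrshift.
rewrite eq_rlshift eq_rshift /=.
by case: eqVneq => [->|]; rewrite ?(negPf xD).
Qed.

Lemma link_mono (B : {set 'I_a}) (y z : 'I_a) :
  y \notin B -> z \notin B -> y <= z -> link F (z |: B) \subset link F (y |: B).
Proof.
move=> yB zB; rewrite leq_eqVlt => /predU1P[/val_inj->//|yz].
apply/subsetP=> D; rewrite !inE => DF.
have := F_shifted DF (i := lshift m y) (j := lshift m z).
have yz' : y != z by apply: contraTneq yz => ->; rewrite ltnn.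
rewrite !in_join_set !inE eqxx negb_or yz' yB => /(_ yz isT isT).
congr (_ \in F); apply: join_setP => x;
  rewrite ?in_swap_elt !in_join_set ?in_swap_elt ?in_setU1.
  rewrite !eq_lshift; case: (eqVneq x y) => //= _.
  by case: eqVneq => [->|]; rewrite ?(negPf zB).
by rewrite !eq_rlshift.
Qed.

End LinkShift.

(** Disjoint tails contribute their full sizes to the union; both exclusions of matchings below rest
    on this count. *)
Lemma propU_link a m s q (F : {set {set 'I_(a + m)}})
    (B : 'I_s.+1 -> {set 'I_a}) (D : 'I_s.+1 -> {set 'I_m}) :
  propU s.+1 q F -> (forall i, D i \in link F (B i)) ->
  (forall i j, i != j -> [disjoint D i & D j]) ->
  #|\bigcup_i B i| + \sum_i #|D i| <= q.
Proof.
move=> FU DF dD; have := FU (fun i => join_set (B i) (D i)).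
rewrite bigcup_join_set card_join_set (card_disjoint_bigcup dD); apply=> i.
by have := DF i; rewrite inE.
Qed.

Lemma card_in_link a m k (F : {set {set 'I_(a + m)}}) B D :
  F \subset ksubsets (a + m) k -> D \in link F B -> #|B| + #|D| = k.
Proof.
by move=> /subsetP Fk; rewrite inE => /Fk; rewrite inE card_join_set => /eqP.
Qed.

Lemma link_ksubsets a m k (F : {set {set 'I_(a + m)}}) B :
  F \subset ksubsets (a + m) k -> link F B \subset ksubsets m (k - #|B|).
Proof.
move=> Fk; apply/subsetP=> D /(card_in_link Fk) <-.
by rewrite inE addKn.
Qed.

(** * Counting over the links *)

(** The index [w - i.+1] runs down to [0] and then stays there by truncation; repeating the least
    value [g 0] cannot raise the average. *)
Lemma sum_clamped_min w s (g : nat -> nat) :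
  w <= s -> (forall j, j < w -> g 0 <= g j) ->
  w * \sum_(i < s) g (w - i.+1) <= s * \sum_(j < w) g j.
Proof.
move=> ws g0.
have -> : \sum_(i < s) g (w - i.+1) = \sum_(j < w) g j + (s - w) * g 0.
  rewrite -(big_mkord xpredT (fun i => g (w - i.+1))) (big_cat_nat (leq0n w) ws) /=.
  congr addn.
    rewrite big_mkord (reindex_inj rev_ord_inj) /=; apply: eq_bigr => i _.
    by congr g; have := ltn_ord i; lia.
  rewrite (@eq_big_nat _ _ _ w s _ (fun=> g 0)) ?sum_nat_const_nat //.
  by move=> i wi; congr g; lia.
have : w * g 0 <= \sum_(j < w) g j.
  rewrite -{1}[w]card_ord -sum_nat_const; apply: leq_sum => j _; exact: g0.
move: (\sum_(j < w) g j) => S wS; rewrite mulnDr mulnCA.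
by rewrite -{2}(subnKC ws) mulnDl leq_add2l leq_mul2l wS orbT.
Qed.

(** Each [C] arises as [y |: B] once for each of its [j + 1] elements [y]. *)
Lemma sum_insert_element (T : finType) (x0 : T) j (h : {set T} -> nat) :
  \sum_(B : {set T} | (x0 \notin B) && (#|B| == j))
    \sum_(y | (y \notin B) && (y != x0)) h (y |: B) =
  j.+1 * \sum_(C : {set T} | (x0 \notin C) && (#|C| == j.+1)) h C.
Proof.
rewrite (exchange_big_dep (fun y => y != x0)) /=; last by move=> B y _ /andP[].
transitivity (\sum_(y | y != x0)
   \sum_(C : {set T} | [&& x0 \notin C, #|C| == j.+1 & y \in C]) h C).
  apply: eq_bigr => y yx0.
  rewrite [RHS](reindex_onto (fun B => y |: B) (fun C => C :\ y)) /=; last first.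
    by move=> C /and3P[_ _]; apply: setD1K.
  apply: eq_bigl => B; rewrite yx0 andbT !inE eqxx negb_or [x0 == y]eq_sym yx0 /=.
  have [yB|yB] := boolP (y \in B).
    rewrite andbF; apply/esym/negbTE; rewrite negb_and; apply/orP; right.
    by apply: contraTneq yB => <-; rewrite !inE eqxx.
  by rewrite cardsU1 yB setU1K ?eqxx //= !andbT.
rewrite (exchange_big_dep (fun C : {set T} => (x0 \notin C) && (#|C| == j.+1))) /=;
  last first.
  by move=> y C _ /and3P[-> ->].
rewrite big_distrr /=; apply: eq_bigr => C /andP[x0C cC].
rewrite (eq_bigl (mem C)); last first.
  move=> y; rewrite x0C cC /=; apply: andb_idl => yC.
  by apply: contraNneq x0C => <-.
by rewrite sum_nat_const (eqP cC).
Qed.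

Section Links.
Variables (p m k s r : nat) (F : {set {set 'I_(p.+1 + m)}}).
Hypotheses (s_gt0 : 0 < s) (hr : 0 < r <= k) (hp : r <= p < s + r).
Hypothesis Fk : F \subset ksubsets (p.+1 + m) k.
Hypothesis FU : propU s.+1 ((k - r) * s.+1 + p) F.
Hypothesis F_shifted : left_shifted F.

(** The number of elements of [[p]] outside an [(r - 1)]-subset; [p < s + r] gives [w <= s]. *)
Let w := p.+1 - r.
Let l := k - r.

(** A matching would give a union of at least [#|B| + (s + 1)(k - #|B|)] points. With
    [k - #|B| = l + (r - #|B|)] this is at least [(s + 1) l + s + r], which exceeds [q] as
    [p < s + r]. *)
Lemma link_no_matching (B : {set 'I_p.+1}) :
  #|B| < r -> ~ rainbow_matching s (fun=> link F B).
Proof.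
move=> Br [D [DF dD]]; have := propU_link FU DF dD.
have : #|B| <= #|\bigcup_(i < s.+1) B|.
  exact/subset_leq_card/(bigcup_sup ord0).
have -> : \sum_i #|D i| = s.+1 * (k - #|B|).
  rewrite (eq_bigr (fun=> k - #|B|)) ?sum_nat_const ?card_ord // => i _.
  by rewrite -(card_in_link Fk (DF i)) addKn.
have -> : k - #|B| = (k - r) + (r - #|B|) by lia.
rewrite mulnDr [s.+1 * (k - r)]mulnC.
have : s + (r - #|B|) <= s.+1 * (r - #|B|).
  by rewrite mulSn addnC leq_add2l leq_pmulr // subn_gt0.
move: Br hp hr; move: #|\bigcup_(_ < _) _| #|_| (_ * _) (_ * _) => U b X Y; lia.
Qed.

Lemma link_step (B : {set 'I_p.+1}) y : #|B| < r -> y \notin B ->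
  #|link F B| <= s * #|link F (y |: B)|.
Proof.
move=> Br yB; apply: (@leq_trans (s * #|shadow (link F B)|)).
  apply: (@shadow_bound m s m (k - #|B|)) => //.
  - exact: link_ksubsets.
  - by move=> A _; apply/subsetP=> x _; rewrite inE.
  - exact: link_left_shifted.
  - exact: link_no_matching.
by rewrite leq_mul2l subset_leq_card ?orbT // shadow_link.
Qed.

(** * The chain of links over an [(r - 1)]-subset of [[p]] *)

Section TopLink.
Variable B : {set 'I_p.+1}.
Hypotheses (B_max : ord_max \notin B) (cB : #|B| = r.-1).

(** The complement of [B] in increasing order, ending with [z w = ord_max], the point [p + 1]; the
    default value also lies outside [B]. *)
Let z i := nth ord_max (enum (~: B)) i.
(* Truncated subtraction: the chain is constant from index [w] on. *)
Let Q i := link F (z (w - i) |: B).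

Lemma size_enum_compl : size (enum (~: B)) = w.+1.
Proof. by rewrite -cardE; have := cardsC B; rewrite card_ord /w; lia. Qed.

Lemma compl_nth_notin i : z i \notin B.
Proof.
rewrite /z; have [lt|ge] := ltnP i (size (enum (~: B))); last by rewrite nth_default.
by have := mem_nth ord_max lt; rewrite mem_enum inE.
Qed.

Lemma compl_nth_mono i j : i <= j <= w -> z i <= z j.
Proof.
move=> /andP[ij jw]; have := @sorted_ltn_gap _ i (j - i) (sorted_enum_set (~: B)).
rewrite size_map size_enum_compl subnKC // => /(_ jw).
rewrite !(nth_map ord_max) ?size_enum_compl //; last exact: leq_ltn_trans ij _.
by apply: leq_trans; apply: leq_addr.
Qed.

Lemma compl_nth_surj y : y \notin B -> exists2 i, i <= w & y = z i.
Proof.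
move=> yB; have ye : y \in enum (~: B) by rewrite mem_enum inE.
exists (index y (enum (~: B))); last by rewrite /z nth_index.
by rewrite -ltnS -size_enum_compl index_mem.
Qed.

Lemma compl_nth_last : z w = ord_max.
Proof.
have [i iw e] := compl_nth_surj B_max; apply: val_inj => /=; apply/eqP.
rewrite eqn_leq -ltnS ltn_ord /= -[X in X <= _]/(val (@ord_max p)) e.
by apply: compl_nth_mono; rewrite iw leqnn.
Qed.

Lemma top_link_nested i : Q i \subset Q i.+1.
Proof.
by apply: link_mono; rewrite ?compl_nth_notin ?compl_nth_mono //; lia.
Qed.

Lemma top_link_no_matching : ~ rainbow_matching s Q.
Proof.
move=> [D [DF dD]].
have := propU_link (B := fun i : 'I_s.+1 => z (w - i) |: B) FU DF dD.
(* As [w <= s], the indices [w - i] reach every element outside [B]; the heads thus cover [p + 1]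
   points, one too many. *)
have -> : \bigcup_(i < s.+1) (z (w - i) |: B) = setT.
  apply/setP=> y; rewrite inE; apply/bigcupP.
  have [yB|/compl_nth_surj[i iw ->]] := boolP (y \in B).
    by exists ord0; rewrite // !inE yB orbT.
  have lt : w - i < s.+1 by rewrite /w; lia.
  by exists (Ordinal lt) => //=; rewrite subKn // setU11.
have -> : \sum_i #|D i| = s.+1 * (k - r).
  rewrite (eq_bigr (fun=> k - r)) ?sum_nat_const ?card_ord // => i _.
  have := card_in_link Fk (DF i); rewrite cardsU1 compl_nth_notin cB; lia.
by rewrite cardsT card_ord mulnC; lia.
Qed.

Lemma top_link_uniform i : Q i \subset ksubsets m l.
Proof.
have := link_ksubsets (z (w - i) |: B) Fk.
by rewrite cardsU1 compl_nth_notin cB add1n prednK //; case/andP: hr.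
Qed.

(** This replaces the circle bound when [l = 0]: the only possible tail is empty, and by nesting it
    would repeat into a matching. *)
Lemma top_link_empty : l = 0 -> link F (ord_max |: B) = set0.
Proof.
move=> l0; apply/eqP; apply: contra_notT top_link_no_matching => /set0Pn[D].
rewrite -compl_nth_last -{1}[w]subn0 => DQ0.
have : D \in ksubsets m l by apply: subsetP DQ0; apply: (top_link_uniform 0).
rewrite inE l0 cards_eq0 => /eqP D0; rewrite {}D0 in DQ0.
have Q0 i : set0 \in Q i.
  by elim: i => // i; apply/subsetP/top_link_nested.
exists (fun=> set0); split=> [i|i j _]; first exact: Q0.
by rewrite -setI_eq0 setI0.
Qed.

(** The factor [w] turns the sum over [s] clamped indices into [s] times the sum over [[p] \ B]: the
    repeated link, that of [z 0], is the largest and misses fewest sets. *)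
Lemma top_link_bound : 0 < l -> s.*2.+1 * l <= m ->
  w * ((m - s * l) * #|link F (ord_max |: B)|) <=
  l * (s * \sum_(y | (y \notin B) && (y != ord_max))
         #|ksubsets m l :\: link F (y |: B)|).
Proof.
move=> l0 lm.
have h := nested_families_bound l0 lm (top_link_uniform 0)
  (fun i _ => top_link_nested i) top_link_no_matching.
rewrite -compl_nth_last -{2}[w]subn0.
apply: leq_trans (leq_mul (leqnn w) h) _; rewrite mulnCA leq_mul2l.
apply/orP; right.
pose g j := #|ksubsets m l :\: link F (z j |: B)|.
apply: (@leq_trans (s * \sum_(j < w) g j)).
  apply: (@sum_clamped_min w s g); first by rewrite /w; lia.
  move=> j jw; apply: subset_leq_card; apply: setDS.
  by apply: link_mono; rewrite ?compl_nth_notin ?compl_nth_mono //; lia.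
rewrite leq_mul2l; apply/orP; right; rewrite leq_eqVlt; apply/orP; left.
have : \sum_(y in ~: B) #|ksubsets m l :\: link F (y |: B)| = \sum_(j < w.+1) g j.
  by rewrite -big_enum (big_nth ord_max) size_enum_compl big_mkord.
rewrite (bigD1 ord_max) ?inE //= big_ord_recr /= /g compl_nth_last addnC.
move/eqP; rewrite eqn_add2r => /eqP <-; apply/eqP.
by apply: eq_bigl => y; rewrite inE.
Qed.

End TopLink.

(** * Level sums weighed against missing sets *)

Let level j := \sum_(B : {set 'I_p.+1} | (ord_max \notin B) && (#|B| == j))
  #|link F (ord_max |: B)|.

(** Sum [link_step] over the [p - j] elements of [[p]] outside each [B]. *)
Lemma level_step j : j.+1 < r -> (p - j) * level j <= s * (j.+1 * level j.+1).
Proof.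
move=> jr.
rewrite -(@sum_insert_element _ ord_max j (fun B => #|link F (ord_max |: B)|)).
rewrite !big_distrr /=; apply: leq_sum => B /andP[maxB /eqP cB].
apply: (@leq_trans (\sum_(y | (y \notin B) && (y != ord_max))
   #|link F (ord_max |: B)|)).
  rewrite sum_nat_const leq_mul2r; apply/orP; right.
  have -> : #|[pred y | (y \notin B) && (y != ord_max)]| = #|~: (ord_max |: B)|.
    by apply: eq_card => y; rewrite !inE negb_or andbC.
  by have := cardsC (ord_max |: B); rewrite cardsU1 maxB cB card_ord; lia.
rewrite big_distrr /=; apply: leq_sum => y /andP[yB ymax].
rewrite setUCA; apply: link_step; first by rewrite cardsU1 maxB cB.
by rewrite !inE negb_or ymax.
Qed.

(** Since [(p - j) C(p, j) = (j + 1) C(p, j + 1)], the ratio of [level j] to [C(p, j)] is at most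
    [s] times the next one. Iteration yields the weights in [fspr]. *)
Lemma level_bound j : j < r ->
  level j * 'C(p, r.-1) <= s ^ (r - 1 - j) * 'C(p, j) * level r.-1.
Proof.
have [d] := ubnP (r - 1 - j); elim: d => // d IH in j * => ltd jr.
have [->|ne] := eqVneq j r.-1.
  by rewrite subn1 subnn expn0 mul1n mulnC.
have jr1 : j.+1 < r by lia.
have pj : 0 < p - j by lia.
rewrite -(leq_pmul2l pj) mulnA.
apply: leq_trans (leq_mul (level_step jr1) (leqnn _)) _.
rewrite -!mulnA; apply: leq_trans (leq_mul (leqnn s) (leq_mul (leqnn j.+1) _)) _.
  by apply: (IH j.+1) => //; lia.
have -> : r - 1 - j = (r - 1 - j.+1).+1 by lia.
rewrite expnS; move: (s ^ _) (level r.-1) (mul_bin_left p j) => X L e.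
rewrite [leqLHS](_ : _ = s * X * L * (j.+1 * 'C(p, j.+1))); last by lia.
by rewrite e leq_eqVlt; apply/orP; left; apply/eqP; lia.
Qed.

(** Counts members of [A_{p,r}] outside [F] that meet [[p + 1]] in exactly an [r]-subset of
    [[p]]. *)
Let missing := \sum_(B : {set 'I_p.+1} | (ord_max \notin B) && (#|B| == r))
  #|ksubsets m l :\: link F B|.

Lemma top_level_bound : 0 < l -> s.*2.+1 * l <= m ->
  w * ((m - s * l) * level r.-1) <= l * (s * (r * missing)).
Proof.
move=> l0 lm.
have := @sum_insert_element _ ord_max r.-1 (fun B => #|ksubsets m l :\: link F B|).
rewrite prednK; last by case/andP: hr.
move=> <-.
rewrite !big_distrr /=; apply: leq_sum => B /andP[maxB /eqP cB].
exact: top_link_bound.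
Qed.

Lemma top_level_empty : l = 0 -> level r.-1 = 0.
Proof.
move=> l0; apply: big1 => B /andP[maxB /eqP cB].
by rewrite top_link_empty // cards0.
Qed.

Lemma in_link_Afam B D : (D \in link (Afam (p.+1 + m) k p r) B) =
  (#|B| + #|D| == k) && (r <= #|B :\ ord_max|).
Proof.
rewrite inE [_ \in Afam _ _ _ _]inE [_ \in ksubsets _ _]inE card_join_set.
congr (_ && (r <= _)).
have -> : join_set B D :&: initseg (p.+1 + m) p = join_set (B :\ ord_max) set0.
  apply: join_setP => x; rewrite in_setI !in_join_set [_ \in initseg _ _]inE /=.
    by rewrite in_setD1 andbC -val_eqE /= ltn_neqAle -ltnS ltn_ord andbT.
  by rewrite in_set0; apply/negbTE; rewrite negb_and -leqNgt orbC; apply/orP; left; lia.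
by rewrite card_join_set cards0 addn0.
Qed.

Lemma sum_split_max (h : {set 'I_p.+1} -> nat) :
  \sum_B h B = \sum_(B : {set 'I_p.+1} | ord_max \notin B) (h B + h (ord_max |: B)).
Proof.
rewrite (bigID (fun B : {set 'I_p.+1} => ord_max \notin B)) big_split /=.
congr addn; rewrite (reindex_onto (fun B => ord_max |: B) (fun B => B :\ ord_max)) /=.
  apply: eq_bigl => B; rewrite negbK setU11 /=.
  have [mB|mB] := boolP (ord_max \in B); last by rewrite setU1K ?eqxx.
  by apply/negbTE; apply: contraTneq mB => <-; rewrite !inE eqxx.
by move=> B; rewrite negbK; apply: setD1K.
Qed.

(** Pair [B] with [ord_max |: B]. If [#|B| < r], both links lie outside [A_{p,r}] and [link_step]
    bounds their total by [s + 1] times the second; otherwise they lie inside, with the missing sets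
    as surplus when [#|B| = r]. *)
Lemma card_compare :
  #|F| + missing <= #|Afam (p.+1 + m) k p r| + s.+1 * \sum_(j < r) level j.
Proof.
pose Lk B := #|link (Afam (p.+1 + m) k p r) B|.
have subA B D : r <= #|B :\ ord_max| -> D \in link F B ->
    D \in link (Afam (p.+1 + m) k p r) B.
  by move=> rB DF; rewrite in_link_Afam rB (card_in_link Fk DF) eqxx.
rewrite !card_sum_link !sum_split_max.
have -> : \sum_(j < r) level j = \sum_(B : {set 'I_p.+1} | ord_max \notin B)
    (if #|B| < r then #|link F (ord_max |: B)| else 0).
  rewrite /level (exchange_big_dep (fun B : {set 'I_p.+1} => ord_max \notin B)) /=;
    last by move=> j B _ /andP[].
  apply: eq_bigr => B maxB; rewrite maxB /=.
  case: ifP => [Br|/negbT Br].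
    rewrite (bigD1 (Ordinal Br)) //= big1 ?addn0 // => j /andP[/eqP e] /eqP[].
    exact: val_inj.
  by rewrite big1 // => j /eqP e; rewrite e ltn_ord in Br.
have -> : missing = \sum_(B : {set 'I_p.+1} | ord_max \notin B)
    (if #|B| == r then #|ksubsets m l :\: link F B| else 0).
  by rewrite /missing big_mkcondr.
rewrite big_distrr -!big_split /=; apply: leq_sum => B maxB.
have DB : B :\ ord_max = B by apply/setDidPl; rewrite disjoint_sym disjoints1.
have DmB : (ord_max |: B) :\ ord_max = B by rewrite setU1K.
have [Br|rB] := ltnP #|B| r.
  rewrite (ltn_eqF Br) addn0 mulSn addnC.
  apply: leq_trans (leq_addl _ _); rewrite leq_add2l; exact: link_step.
rewrite muln0 addn0.
have le2 : #|link F (ord_max |: B)| <= Lk (ord_max |: B).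
  by apply/subset_leq_card/subsetP=> D; apply: subA; rewrite DmB.
rewrite addnAC leq_add //; case: eqP => [eB|_]; last first.
  by rewrite addn0; apply/subset_leq_card/subsetP=> D; apply: subA; rewrite DB.
rewrite -(cardsID (link F B) (link (Afam _ _ _ _) B)) leq_add //.
  apply/subset_leq_card/subsetP=> D DF; rewrite inE DF andbT; apply: subA => //.
  by rewrite DB.
apply/subset_leq_card/setSD/subsetP=> D; rewrite in_link_Afam DB rB andbT inE.
by move=> /eqP ->; rewrite eB subnKC //; case/andP: hr.
Qed.

Lemma shifted_bound :
  (s * 'C(p, r) + s * s.+1 * \sum_(j < r) s ^ (r - 1 - j) * 'C(p, j)) * l
    <= m * 'C(p, r) ->
  #|F| <= #|Afam (p.+1 + m) k p r|.
Proof.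
set Sg := \sum_(j < r) _ => hm.
set T := \sum_(j < r) level j.
suff TM : s.+1 * T <= missing.
  by rewrite -(leq_add2r missing) (leq_trans card_compare) // leq_add2l.
have c1 : 0 < 'C(p, r.-1) by rewrite bin_gt0; lia.
have hT : T * 'C(p, r.-1) <= Sg * level r.-1.
  by rewrite !big_distrl /=; apply: leq_sum => j _; apply: level_bound.
have [l0|l0] := posnP l.
  move: hT; rewrite (top_level_empty l0) muln0 leqn0 muln_eq0 (gtn_eqF c1) orbF => /eqP->.
  by rewrite muln0.
have c0 : 0 < 'C(p, r) by rewrite bin_gt0; case/andP: hp.
have er : r.-1.+1 = r by rewrite prednK //; case/andP: hr.
have w0 : 0 < p.+1 - r by lia.
have ebin : r * 'C(p, r) = (p.+1 - r) * 'C(p, r.-1).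
  by have := mul_bin_left p r.-1; rewrite er => ->; congr muln; lia.
have sl : s * l * 'C(p, r) + s * s.+1 * Sg * l <= m * 'C(p, r).
  by apply: leq_trans hm; rewrite mulnDl mulnAC.
have hml : s * s.+1 * Sg * l <= (m - s * l) * 'C(p, r).
  by rewrite mulnBl leq_subRL ?(leq_trans _ sl) ?leq_addr.
(* From the last term [C(p, r - 1)] of [Sg] and [w <= s]. With it the threshold yields
   [m >= (2 s + 1) l], as the circle bound requires. *)
have cSg : 'C(p, r) <= s * Sg.
  have h1 : 'C(p, r.-1) <= Sg.
    rewrite /Sg -[in X in _ <= X]er big_ord_recr /= er subn1 subnn mul1n.
    exact: leq_addl.
  apply: leq_trans (leq_mul (leqnn s) h1).
  have r0 : 0 < r by case/andP: hr.
  rewrite -(leq_pmul2l r0) ebin mulnA leq_mul2r; apply/orP; right.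
  by apply: (@leq_trans s); [lia | rewrite leq_pmull].
have lm : s.*2.+1 * l <= m.
  rewrite -(leq_pmul2r c0); apply: leq_trans sl.
  have -> : s.*2.+1 * l * 'C(p, r) = s * l * 'C(p, r) + s.+1 * l * 'C(p, r).
    by rewrite -mulnDl -mulnDl addnS addnn.
  rewrite leq_add2l -mulnA [s * s.+1]mulnC -!mulnA leq_mul2l /=.
  by rewrite mulnC mulnA leq_mul2r cSg orbT.
have hS := top_level_bound l0 lm.
have slw : 0 < s * l * (p.+1 - r) by rewrite !muln_gt0 s_gt0 l0.
(* Scaling by [s l w C(p, r - 1)] lets [hT], [hml], [hS] and [ebin] be chained without division. *)
rewrite -(leq_pmul2l c1) -(leq_pmul2l slw).
apply: (@leq_trans ((s * s.+1 * Sg * l) * ((p.+1 - r) * level r.-1))).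
  move: hT; move: 'C(_, _) => c hT.
  rewrite [leqLHS](_ : _ = s * s.+1 * l * (p.+1 - r) * (T * c)); last by lia.
  rewrite [leqRHS](_ : _ = s * s.+1 * l * (p.+1 - r) * (Sg * level r.-1)); last by lia.
  by rewrite leq_mul2l hT orbT.
apply: leq_trans (leq_mul hml (leqnn _)) _.
rewrite [leqLHS](_ : _ = 'C(p, r) * ((p.+1 - r) * ((m - s * l) * level r.-1))); last by lia.
apply: leq_trans (leq_mul (leqnn _) hS) _.
rewrite [leqLHS](_ : _ = s * l * (r * 'C(p, r)) * missing); last by lia.
by rewrite ebin !mulnA.
Qed.

End Links.

(** * Clearing denominators and reduction to shifted families *)

Lemma threshold_nat n l s p r : r <= p ->
  ((p + 1)%:R + (s%:R + fspr s p r) * l%:R <= n%:R :> rat)%R ->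
  (p + 1) * 'C(p, r) + (s * 'C(p, r) +
    s * (s + 1) * \sum_(j < r) s ^ (r - 1 - j) * 'C(p, j)) * l <= n * 'C(p, r).
Proof.
move=> rp; rewrite /fspr; set Sg := (\sum_(j < r) _)%N; set c := 'C(p, r).
have c0 : 0 < c by rewrite bin_gt0.
have c0R : (0 < c%:R :> rat)%R by rewrite ltr0n.
rewrite -(ler_pM2r c0R) => h; rewrite -(ler_nat rat) [(n * c)%:R%R]natrM.
apply: le_trans h.
rewrite le_eqVlt; apply/orP; left; apply/eqP.
rewrite !natrD !natrM !natrD !natrM; field.
by rewrite pnatr_eq0 -lt0n.
Qed.

Theorem theorem4 (n k s p r : nat) (F : {set {set 'I_n}})
  (hs : 1 <= s) (hr : 1 <= r <= k) (hp : r <= p <= s + r - 1)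
  (hFk : F \subset ksubsets n k)
  (hFU : propU (s + 1) ((k - r) * (s + 1) + p) F)
  (hn : ((p + 1)%:R + (s%:R + fspr s p r) * (k - r)%:R <= n%:R :> rat)%R) :
  #|F| <= #|Afam n k p r|.
Proof.
have rp : r <= p by case/andP: hp.
have c0 : 0 < 'C(p, r) by rewrite bin_gt0.
have := threshold_nat rp hn; set t := (_ * (k - r)) => ht.
(* The threshold is at least [p + 1], so the ground set splits into [p + 1] head points and [m] tail
   points. *)
have pn : p.+1 <= n.
  by rewrite -(leq_pmul2r c0) (leq_trans _ ht) // -addn1 leq_addr.
have [m en] : exists m, n = p.+1 + m by exists (n - p.+1); rewrite subnKC.
subst n; rewrite addn1 in hFU; rewrite addn1 mulnDl leq_add2l in ht.
have [F' [F'k F'U <- F's]] := left_shifted_witness hFk hFU.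
apply: (shifted_bound hs hr _ F'k F'U F's); first by lia.
by move: ht; rewrite /t addn1.
Qed.
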